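(* Let $n\ge 1$ and consider peg solitaire on the triangular board $T_n$. Consider the problem of starting from the position in which every hole holds a peg except the hole with skew coordinates $(x_s,y_s)$, and reaching by a sequence of jumps the position in which exactly one peg remains, located at the hole $(x_f,y_f)$. A necessary condition for this problem to be solvable is: (1) if $n\equiv 1 \pmod 3$, then $x_s+y_s\not\equiv 0 \pmod 3$ and $x_s+y_s+x_f+y_f\equiv 0 \pmod 3$; or (2) if $n\not\equiv 1 \pmod 3$, then $x_s+y_s\equiv x_f+y_f \pmod 3$. Moreover, for $n\ge 6$, this condition is also sufficient: if $n\ge 6$ and the condition holds, the problem is solvable.
   Context: The triangular board $T_n$ is the set of holes with integer skew coordinates $(x,y)$ satisfying $0\le x\le y\le n-1$. A board position assigns to each hole either a peg or no peg. A jump takes a peg at hole $p$, jumps it over a peg at an adjacent hole $p+d$ into an empty hole $p+2d$, where $d$ is one of the six directions $(\pm1,0)$, $(0,\pm1)$, $(1,1)$, $(-1,-1)$ and all three holes $p,p+d,p+2d$ lie in $T_n$; the jumped-over peg at $p+d$ is removed. *)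

(* Defs.v *)
From Stdlib Require Import ZArith Relations.
Open Scope Z_scope.

Definition in_board (n : Z) (x y : Z) : Prop := 0 <= x /\ x <= y /\ y <= n - 1.

(* A board position: peg (true) / no peg (false) at each hole; values outside
   the board are irrelevant. *)
Definition position := Z -> Z -> bool.

Definition is_dir (dx dy : Z) : Prop :=
  (dx = 1 /\ dy = 0) \/ (dx = -1 /\ dy = 0) \/ (dx = 0 /\ dy = 1) \/
  (dx = 0 /\ dy = -1) \/ (dx = 1 /\ dy = 1) \/ (dx = -1 /\ dy = -1).

Definition upd (P : position) (a b : Z) (v : bool) : position :=
  fun x y => if (Z.eqb x a && Z.eqb y b)%bool then v else P x y.

Definition jump (n : Z) (P Q : position) : Prop :=
  exists x y dx dy,
    is_dir dx dy /\
    in_board n x y /\ in_board n (x + dx) (y + dy) /\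
    in_board n (x + 2 * dx) (y + 2 * dy) /\
    P x y = true /\ P (x + dx) (y + dy) = true /\ P (x + 2 * dx) (y + 2 * dy) = false /\
    Q = upd (upd (upd P x y false) (x + dx) (y + dy) false)
            (x + 2 * dx) (y + 2 * dy) true.

Definition reachable (n : Z) : position -> position -> Prop :=
  clos_refl_trans position (jump n).

Definition start_pos (xs ys : Z) : position :=
  fun x y => negb (Z.eqb x xs && Z.eqb y ys)%bool.

Definition single_peg_at (n : Z) (P : position) (xf yf : Z) : Prop :=
  forall x y, in_board n x y -> (P x y = true <-> (x = xf /\ y = yf)).

Definition solvable (n xs ys xf yf : Z) : Prop :=
  exists Q, reachable n (start_pos xs ys) Q /\ single_peg_at n Q xf yf.

Definition necessary_condition (n xs ys xf yf : Z) : Prop :=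
  (n mod 3 = 1 ->
     (xs + ys) mod 3 <> 0 /\ (xs + ys + xf + yf) mod 3 = 0) /\
  (n mod 3 <> 1 -> (xs + ys) mod 3 = (xf + yf) mod 3).

(* Main.v *)
(** Necessity: the three cells of a jump lie in the three classes of [x + y] modulo 3, so a
    jump flips the parity of the number of pegs in each class.

    Sufficiency, by induction on [n] in steps of 3: rows are removed at the bottom.  If a
    peg and a hole face each other across the first peg of a line of three, the line can be
    removed without any other change; in this way a strip of three rows is swept column by
    column, starting from an empty column, and its two ends are cleared with the help of one
    peg in a corner of the smaller triangle.  If a hole appears in the last row of the
    smaller triangle, the first column can be removed in every strip below.  So a full
    board with a hole near the last row of a smaller triangle can be reduced to that triangle
    with one hole.  Up to the symmetries of the triangle and the reversal of solutions
    (complement all positions) this gives the induction step, unless the start and the finish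
    are both very close to the same corner.  In this case the lower rows are removed in the
    middle of a solution of the board of size 6, 7 or 8.  These small boards are settled by
    explicit solutions found by computer. *)

Require Import Defs.
From Stdlib Require Import ZArith Relations Lia ZifyBool List Bool.
Import ListNotations.
Open Scope Z_scope.

(** * Reachability up to agreement on the board *)

Definition agree (n : Z) (P Q : position) : Prop :=
  forall x y, in_board n x y -> P x y = Q x y.

(** A jump fixes its result as a function, also off the board. Allowing agreement at the end gives a
    relation that can be adjusted at both ends without functional extensionality. *)
Definition reach (n : Z) (P Q : position) : Prop :=
  exists R, reachable n P R /\ agree n R Q.

Lemma agree_refl n P : agree n P P.
Proof. intros x y _; reflexivity. Qed.

Lemma agree_sym n P Q : agree n P Q -> agree n Q P.
Proof. intros H x y B; symmetry; auto. Qed.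

Lemma agree_trans n P Q R : agree n P Q -> agree n Q R -> agree n P R.
Proof. intros H K x y B; rewrite H, K; auto. Qed.

Lemma agree_reach n P Q : agree n P Q -> reach n P Q.
Proof. intros H; exists P; split; [apply rt_refl | exact H]. Qed.

(** A jump reads only cells of the board, so the same jumps can be played from [P']. *)
Lemma reachable_agree n P Q P' :
  reachable n P Q -> agree n P P' -> reach n P' Q.
Proof.
  intros H; revert P'.
  induction H as [P Q (x & y & dx & dy & D & B1 & B2 & B3 & E1 & E2 & E3 & ->)
                 | P | P Q R _ IH1 _ IH2]; intros P' A.
  - eexists; split.
    + apply rt_step. exists x, y, dx, dy.
      repeat split; try apply D; try apply B1; try apply B2; try apply B3.
      all: rewrite <- A by assumption; assumption.
    + intros u v B; unfold upd; rewrite (A u v B); reflexivity.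
  - apply agree_reach, agree_sym, A.
  - destruct (IH1 _ A) as (Q' & R1 & A1).
    destruct (IH2 _ (agree_sym _ _ _ A1)) as (R' & R2 & A2).
    exists R'; split; [eapply rt_trans; eassumption | exact A2].
Qed.

Lemma reach_trans n P Q R : reach n P Q -> reach n Q R -> reach n P R.
Proof.
  intros (Q' & R1 & A1) (R' & R2 & A2).
  destruct (reachable_agree _ _ _ _ R2 (agree_sym _ _ _ A1)) as (S & R3 & A3).
  exists S; split; [eapply rt_trans; eassumption | eapply agree_trans; eassumption].
Qed.

Lemma reach_agree_l n P P' Q : agree n P P' -> reach n P' Q -> reach n P Q.
Proof. intros A; apply reach_trans, agree_reach, A. Qed.

Lemma reach_agree_r n P Q Q' : reach n P Q' -> agree n Q' Q -> reach n P Q.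
Proof. intros R A; eapply reach_trans; [exact R | apply agree_reach, A]. Qed.

Lemma jump_reach n P Q : jump n P Q -> reach n P Q.
Proof. intros J; exists Q; split; [apply rt_step, J | apply agree_refl]. Qed.

(** Serves for the symmetries of the board and for [cut], which plays a smaller board inside a
    larger one. *)
Lemma reach_map n n' (F : position -> position) :
  (forall P Q, agree n P Q -> agree n' (F P) (F Q)) ->
  (forall P Q, jump n P Q -> reach n' (F P) (F Q)) ->
  forall P Q, reach n P Q -> reach n' (F P) (F Q).
Proof.
  intros HA HJ P Q (R & HR & A).
  apply (reach_agree_r _ _ _ (F R)); [clear A | auto].
  induction HR as [P R J | P | P R S _ IH1 _ IH2].
  - auto.
  - apply agree_reach, agree_refl.
  - eapply reach_trans; eassumption.
Qed.

Definition one_peg (a b : Z) : position := fun x y => (x =? a) && (y =? b).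

Lemma solvable_iff n xs ys xf yf :
  solvable n xs ys xf yf <-> reach n (start_pos xs ys) (one_peg xf yf).
Proof.
  split; intros (Q & R & H); exists Q; (split; [exact R |]).
  - intros x y B. unfold one_peg. specialize (H x y B). destruct (Q x y); lia.
  - intros x y B. rewrite (H x y B). unfold one_peg. lia.
Qed.

(** * Replaying explicit jump sequences *)

(** A finite list of known cells, on which jumps can be computed. Coordinates are relative to an
    origin [(ox, oy)] that may contain variables, so one concrete run serves for a family of
    places. *)
Definition window := list (Z * Z * bool).

Fixpoint look (W : window) (x y : Z) : option bool :=
  match W with
  | [] => None
  | (a, b, v) :: W' => if (x =? a) && (y =? b) then Some v else look W' x y
  end.

Definition put (a b : Z) (v : bool) (W : window) : window :=
  map (fun '(x, y, w) => (x, y, if (x =? a) && (y =? b) then v else w)) W.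

Definition patch (ox oy : Z) (W : window) (P : position) : position :=
  fun x y => match look W (x - ox) (y - oy) with Some v => v | None => P x y end.

Definition move := (Z * Z * (Z * Z))%type.

Definition dirb (dx dy : Z) : bool :=
  ((dx =? 1) && (dy =? 0)) || ((dx =? -1) && (dy =? 0)) ||
  ((dx =? 0) && (dy =? 1)) || ((dx =? 0) && (dy =? -1)) ||
  ((dx =? 1) && (dy =? 1)) || ((dx =? -1) && (dy =? -1)).

(** A jump touching an unlisted cell fails, so a successful run does not depend on the rest of the
    board. *)
Definition step (W : window) (mv : move) : option window :=
  let '(x, y, (dx, dy)) := mv in
  match dirb dx dy, look W x y, look W (x + dx) (y + dy),
        look W (x + (dx + dx)) (y + (dy + dy)) with
  | true, Some true, Some true, Some false =>
      Some (put (x + (dx + dx)) (y + (dy + dy)) true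
             (put (x + dx) (y + dy) false (put x y false W)))
  | _, _, _, _ => None
  end.

Fixpoint run (W : window) (ms : list move) : option window :=
  match ms with
  | [] => Some W
  | mv :: ms' => match step W mv with Some W' => run W' ms' | None => None end
  end.

Definition inside (n ox oy : Z) (W : window) : Prop :=
  Forall (fun '(x, y, _) => in_board n (ox + x) (oy + y)) W.

Lemma look_put W a b v x y :
  look (put a b v W) x y =
  match look W x y with
  | Some w => Some (if (x =? a) && (y =? b) then v else w)
  | None => None
  end.
Proof.
  induction W as [|[[c d] w] W IH]; simpl; [reflexivity |].
  destruct ((x =? c) && (y =? d)) eqn:E; [| exact IH].
  apply andb_prop in E as [E1 E2].
  apply Z.eqb_eq in E1, E2; subst; reflexivity.
Qed.

Lemma look_inside n ox oy W x y v :
  inside n ox oy W -> look W x y = Some v -> in_board n (ox + x) (oy + y).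
Proof.
  induction 1 as [|[[c d] w] W B _ IH]; simpl; [discriminate |].
  destruct ((x =? c) && (y =? d)) eqn:E; [| exact IH].
  apply andb_prop in E as [E1 E2].
  apply Z.eqb_eq in E1, E2; subst; intros _; exact B.
Qed.

Lemma put_inside n ox oy a b v W : inside n ox oy W -> inside n ox oy (put a b v W).
Proof.
  intros H; apply Forall_map; revert H; apply Forall_impl.
  intros [[c d] w]; trivial.
Qed.

Lemma dirb_dir dx dy : dirb dx dy = true -> is_dir dx dy.
Proof. unfold dirb, is_dir; lia. Qed.

Lemma patch_at ox oy W P x y v :
  look W x y = Some v -> patch ox oy W P (ox + x) (oy + y) = v.
Proof.
  intros H; unfold patch.
  replace (ox + x - ox) with x by lia; replace (oy + y - oy) with y by lia.
  rewrite H; reflexivity.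
Qed.

Lemma upd_ext P Q a b v :
  (forall x y, P x y = Q x y) -> forall x y, upd P a b v x y = upd Q a b v x y.
Proof. intros H x y; unfold upd; rewrite H; reflexivity. Qed.

Lemma patch_put ox oy W P a b v w :
  look W a b = Some w ->
  forall x y, patch ox oy (put a b v W) P x y = upd (patch ox oy W P) (ox + a) (oy + b) v x y.
Proof.
  intros H x y; unfold patch, upd; rewrite look_put.
  replace (x =? ox + a) with (x - ox =? a) by lia.
  replace (y =? oy + b) with (y - oy =? b) by lia.
  destruct ((x - ox =? a) && (y - oy =? b)) eqn:E.
  - apply andb_prop in E as [E1 E2]; apply Z.eqb_eq in E1, E2.
    rewrite E1, E2, H; reflexivity.
  - destruct (look W (x - ox) (y - oy)); reflexivity.
Qed.

Lemma step_reach n ox oy W mv W' P :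
  inside n ox oy W -> step W mv = Some W' ->
  reach n (patch ox oy W P) (patch ox oy W' P) /\ inside n ox oy W'.
Proof.
  destruct mv as [[x y] [dx dy]]; intros B; unfold step.
  destruct (dirb dx dy) eqn:D; [| discriminate].
  destruct (look W x y) as [[|]|] eqn:E1; try discriminate.
  destruct (look W (x + dx) (y + dy)) as [[|]|] eqn:E2; try discriminate.
  destruct (look W (x + (dx + dx)) (y + (dy + dy))) as [[|]|] eqn:E3; try discriminate.
  intros [= <-]; split; [| repeat apply put_inside; exact B].
  eapply reach_agree_r.
  - apply jump_reach.
    exists (ox + x), (oy + y), dx, dy.
    split; [apply dirb_dir, D |].
    split; [eapply look_inside; eassumption |].
    replace (ox + x + dx) with (ox + (x + dx)) by lia.
    replace (oy + y + dy) with (oy + (y + dy)) by lia.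
    replace (ox + x + 2 * dx) with (ox + (x + (dx + dx))) by lia.
    replace (oy + y + 2 * dy) with (oy + (y + (dy + dy))) by lia.
    split; [eapply look_inside; eassumption |].
    split; [eapply look_inside; eassumption |].
    split; [apply patch_at, E1 |].
    split; [apply patch_at, E2 |].
    split; [apply patch_at, E3 | reflexivity].
  - intros u v _; symmetry.
    erewrite patch_put by (rewrite !look_put, E3; reflexivity).
    apply upd_ext; clear u v; intros u v.
    erewrite patch_put by (rewrite !look_put, E2; reflexivity).
    apply upd_ext; clear u v; intros u v.
    eapply patch_put; exact E1.
Qed.

Lemma run_reach n ox oy ms : forall W W' P,
  inside n ox oy W -> run W ms = Some W' ->
  reach n (patch ox oy W P) (patch ox oy W' P) /\ inside n ox oy W'.
Proof.
  induction ms as [|mv ms IH]; simpl; intros W W' P B.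
  - intros [= <-]; split; [apply agree_reach, agree_refl | exact B].
  - destruct (step W mv) as [V|] eqn:E; [| discriminate]; intros H.
    destruct (step_reach _ _ _ _ _ _ P B E) as [R1 B1].
    destruct (IH _ _ P B1 H) as [R2 B2].
    split; [eapply reach_trans; eassumption | exact B2].
Qed.

Lemma patch_matches ox oy P W :
  Forall (fun '(x, y, v) => P (ox + x) (oy + y) = v) W ->
  forall x y, patch ox oy W P x y = P x y.
Proof.
  intros H x y; unfold patch.
  enough (forall u w, look W (x - ox) (y - oy) = Some w -> u = P x y -> w = u) as K
    by (destruct (look W (x - ox) (y - oy)); [eapply K |]; reflexivity).
  induction H as [|[[c d] w] W E _ IH]; simpl; [discriminate |].
  destruct ((x - ox =? c) && (y - oy =? d)) eqn:T; [| exact IH].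
  intros u w' [= ->] ->; rewrite <- E; f_equal; lia.
Qed.

(** The run is computed on constants; variables enter only through the comparison with [P] at the
    listed cells and with [Q] at the end. *)
Lemma replay n ox oy W ms W' P Q :
  run W ms = Some W' ->
  Forall (fun '(x, y, v) => in_board n (ox + x) (oy + y) /\ P (ox + x) (oy + y) = v) W ->
  agree n (patch ox oy W' P) Q ->
  reach n P Q.
Proof.
  intros R F A.
  assert (B : inside n ox oy W)
    by (revert F; apply Forall_impl; intros [[x y] v] [H _]; exact H).
  assert (M : forall x y, patch ox oy W P x y = P x y).
  { apply patch_matches; revert F; apply Forall_impl; intros [[x y] v] [_ H]; exact H. }
  apply (reach_agree_l _ _ (patch ox oy W P)); [intros x y _; symmetry; apply M |].
  eapply reach_agree_r; [apply (run_reach _ _ _ _ _ _ P B R) | exact A].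
Qed.

(** * The parity invariants *)

(** Parities are sums in the field with two elements, with [xorb] as addition. *)
Fixpoint xsum (f : Z -> bool) (k : nat) : bool :=
  match k with
  | O => false
  | S k' => xorb (f (Z.of_nat k')) (xsum f k')
  end.

Definition total (n : Z) (F : Z -> Z -> bool) : bool :=
  xsum (fun y => xsum (fun x => F x y) (S (Z.to_nat y))) (Z.to_nat n).

Lemma xsum_ext f g k :
  (forall i, 0 <= i -> i < Z.of_nat k -> f i = g i) -> xsum f k = xsum g k.
Proof.
  induction k as [|k IH]; intros H; cbn [xsum]; [reflexivity |].
  rewrite H, IH by (intros; try apply H; lia); reflexivity.
Qed.

(** The flag [d] lets the lemma serve twice in [total_flip]: within a row, where a flip happens only
    if [y = b], and across the rows. *)
Lemma xsum_flip f g a d k :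
  (forall i, g i = xorb (f i) ((i =? a) && d)) ->
  xsum g k = xorb (xsum f k) ((0 <=? a) && (a <? Z.of_nat k) && d).
Proof.
  intros H; induction k as [|k IH]; cbn [xsum].
  - destruct d, (0 <=? a) eqn:E; lia.
  - rewrite H, IH.
    replace (a <? Z.of_nat (S k)) with ((a <? Z.of_nat k) || (Z.of_nat k =? a)) by lia.
    destruct (Z.of_nat k =? a) eqn:E.
    + replace (a <? Z.of_nat k) with false by lia; replace (0 <=? a) with true by lia.
      destruct d, (f (Z.of_nat k)), (xsum f k); reflexivity.
    + destruct d, (f (Z.of_nat k)), (xsum f k), (0 <=? a), (a <? Z.of_nat k); reflexivity.
Qed.

Lemma total_ext n F G :
  (forall x y, in_board n x y -> F x y = G x y) -> total n F = total n G.
Proof.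
  intros H; apply xsum_ext; intros y H0 H1; apply xsum_ext; intros x H2 H3.
  apply H; unfold in_board; lia.
Qed.

Lemma total_flip n F a b d : in_board n a b ->
  total n (fun x y => xorb (F x y) ((x =? a) && (y =? b) && d)) = xorb (total n F) d.
Proof.
  unfold in_board; intros B; unfold total.
  erewrite (xsum_flip (fun y => xsum (fun x => F x y) (S (Z.to_nat y))) _ b d).
  - replace (0 <=? b) with true by lia.
    replace (b <? Z.of_nat (Z.to_nat n)) with true by lia; reflexivity.
  - intros y.
    rewrite (xsum_flip (fun x => F x y) _ a ((y =? b) && d))
      by (intros x; rewrite andb_assoc; reflexivity).
    f_equal; destruct (y =? b) eqn:E; [| rewrite andb_false_r; reflexivity].
    replace (0 <=? a) with true by lia.
    replace (a <? Z.of_nat (S (Z.to_nat y))) with true by lia; reflexivity.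
Qed.

(** Of the three cells of a jump exactly two do not lie in class [k], since the three cells
    lie in three different classes modulo 3. *)
Definition weight (k x y : Z) : bool := negb ((x + y) mod 3 =? k).

Definition parity (n k : Z) (P : position) : bool :=
  total n (fun x y => P x y && weight k x y).

Lemma weight_line k x y dx dy : is_dir dx dy -> 0 <= k < 3 ->
  xorb (weight k x y) (xorb (weight k (x + dx) (y + dy)) (weight k (x + 2 * dx) (y + 2 * dy)))
  = false.
Proof.
  intros D Hk; unfold weight.
  replace (x + dx + (y + dy)) with ((x + y) + (dx + dy)) by lia.
  replace (x + 2 * dx + (y + 2 * dy)) with ((x + y) + 2 * (dx + dy)) by lia.
  rewrite (Z.add_mod (x + y) (dx + dy)), (Z.add_mod (x + y) (2 * (dx + dy))) by lia.
  pose proof (Z.mod_pos_bound (x + y) 3).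
  assert ((x + y) mod 3 = 0 \/ (x + y) mod 3 = 1 \/ (x + y) mod 3 = 2) as Hr by lia.
  assert (k = 0 \/ k = 1 \/ k = 2) as Hc by lia.
  unfold is_dir in D.
  destruct D as [[-> ->] | [[-> ->] | [[-> ->] | [[-> ->] | [[-> ->] | [-> ->]]]]]];
    destruct Hr as [-> | [-> | ->]], Hc as [-> | [-> | ->]]; reflexivity.
Qed.

Lemma jump_parity n k P Q : 0 <= k < 3 -> jump n P Q -> parity n k P = parity n k Q.
Proof.
  intros Hk (x & y & dx & dy & D & B1 & B2 & B3 & E1 & E2 & E3 & ->).
  pose proof (weight_line k x y dx dy D Hk) as L.
  unfold parity; symmetry.
  set (F := fun x y => P x y && weight k x y).
  (* The jump flips three distinct cells and so adds their weights to the total; by [L] these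
     cancel. *)
  etransitivity; [apply total_ext with (G := fun u v =>
    xorb (xorb (xorb (F u v) ((u =? x) && (v =? y) && weight k x y))
      ((u =? x + dx) && (v =? y + dy) && weight k (x + dx) (y + dy)))
      ((u =? x + 2 * dx) && (v =? y + 2 * dy) && weight k (x + 2 * dx) (y + 2 * dy))) |].
  - assert (D0 : dx <> 0 \/ dy <> 0) by (unfold is_dir in D; lia).
    intros u v _; unfold upd, F.
    destruct ((u =? x + 2 * dx) && (v =? y + 2 * dy)) eqn:C3;
      [| destruct ((u =? x + dx) && (v =? y + dy)) eqn:C2;
        [| destruct ((u =? x) && (v =? y)) eqn:C1]].
    + replace ((u =? x + dx) && (v =? y + dy)) with false by lia.
      replace ((u =? x) && (v =? y)) with false by lia.
      replace u with (x + 2 * dx) by lia; replace v with (y + 2 * dy) by lia.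
      rewrite E3; destruct (weight k (x + 2 * dx) (y + 2 * dy)); reflexivity.
    + replace ((u =? x) && (v =? y)) with false by lia.
      replace u with (x + dx) by lia; replace v with (y + dy) by lia.
      rewrite E2; destruct (weight k (x + dx) (y + dy)); reflexivity.
    + replace u with x by lia; replace v with y by lia.
      rewrite E1; destruct (weight k x y); reflexivity.
    + cbn [andb]; rewrite !xorb_false_r; reflexivity.
  - rewrite !total_flip by assumption.
    rewrite !xorb_assoc, L, xorb_false_r; reflexivity.
Qed.

Lemma reachable_parity n k P Q :
  0 <= k < 3 -> reachable n P Q -> parity n k P = parity n k Q.
Proof.
  intros Hk; induction 1 as [P Q J | P | P Q R _ IH1 _ IH2];
    [apply jump_parity; assumption | reflexivity | congruence].
Qed.

(** Three consecutive cells of a row meet every class once and contribute an even weight, so only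
    the length modulo 3 matters. *)
Lemma row_parity k y (j : nat) : 0 <= k < 3 ->
  xsum (fun x => weight k x y) j =
  if Z.of_nat j mod 3 =? 0 then false else
  if Z.of_nat j mod 3 =? 1 then weight k 0 y else xorb (weight k 0 y) (weight k 1 y).
Proof.
  intros Hk; unfold weight; induction j as [|j IH]; cbn [xsum]; [reflexivity |].
  rewrite IH, Nat2Z.inj_succ; unfold Z.succ.
  rewrite (Zplus_mod (Z.of_nat j) y), <- (Zplus_mod_idemp_l (Z.of_nat j) 1),
    Z.add_0_l, <- (Zplus_mod_idemp_r y 1).
  pose proof (Z.mod_pos_bound y 3); pose proof (Z.mod_pos_bound (Z.of_nat j) 3).
  assert (y mod 3 = 0 \/ y mod 3 = 1 \/ y mod 3 = 2) as Hy by lia.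
  assert (Z.of_nat j mod 3 = 0 \/ Z.of_nat j mod 3 = 1 \/ Z.of_nat j mod 3 = 2) as Hj by lia.
  assert (k = 0 \/ k = 1 \/ k = 2) as Hc by lia.
  destruct Hy as [-> | [-> | ->]], Hj as [-> | [-> | ->]], Hc as [-> | [-> | ->]]; reflexivity.
Qed.

(** Rows with [y] congruent to 0 or 1 modulo 3 contribute [negb (k =? 0)] each, the others nothing,
    so the sum has period 3 in [m]. *)
Lemma full_parity k (m : nat) : 0 <= k < 3 ->
  xsum (fun y => xsum (fun x => weight k x y) (S (Z.to_nat y))) m =
  (Z.of_nat m mod 3 =? 1) && negb (k =? 0).
Proof.
  intros Hk; induction m as [|m IH]; cbn [xsum]; [reflexivity |].
  change (xorb (weight k (Z.of_nat (Z.to_nat (Z.of_nat m))) (Z.of_nat m)) _)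
    with (xsum (fun x => weight k x (Z.of_nat m)) (S (Z.to_nat (Z.of_nat m)))).
  rewrite Nat2Z.id, row_parity by assumption.
  change (xsum _ m) with
    (xsum (fun y => xsum (fun x => weight k x y) (S (Z.to_nat y))) m).
  rewrite IH, Nat2Z.inj_succ; unfold Z.succ, weight.
  rewrite <- (Zplus_mod_idemp_l (Z.of_nat m) 1), Z.add_0_l,
    <- (Zplus_mod_idemp_r (Z.of_nat m) 1).
  pose proof (Z.mod_pos_bound (Z.of_nat m) 3).
  assert (Z.of_nat m mod 3 = 0 \/ Z.of_nat m mod 3 = 1 \/ Z.of_nat m mod 3 = 2) as Hm by lia.
  assert (k = 0 \/ k = 1 \/ k = 2) as Hc by lia.
  destruct Hm as [-> | [-> | ->]], Hc as [-> | [-> | ->]]; reflexivity.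
Qed.

Lemma total_false n : total n (fun _ _ => false) = false.
Proof.
  assert (H : forall f k, (forall i, f i = false) -> xsum f k = false)
    by (intros f k Hf; induction k as [|k IH]; cbn [xsum]; [| rewrite Hf, IH]; reflexivity).
  apply H; intros y; apply H; reflexivity.
Qed.

Lemma solvable_necessary n xs ys xf yf :
  1 <= n -> in_board n xs ys -> in_board n xf yf ->
  solvable n xs ys xf yf -> necessary_condition n xs ys xf yf.
Proof.
  intros Hn Bs Bf H; apply solvable_iff in H as (Q & R & A).
  (* The invariants of the first and the last position are equated; the three instances rule out
     every pair of classes that violates the condition. *)
  assert (K : forall k, 0 <= k < 3 ->
    xorb ((n mod 3 =? 1) && negb (k =? 0)) (weight k xs ys) = weight k xf yf).
  { intros k Hk; pose proof (reachable_parity n k _ _ Hk R) as E; unfold parity in E.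
    rewrite (total_ext n (fun x y => Q x y && _)
      (fun x y => xorb false ((x =? xf) && (y =? yf) && weight k xf yf))) in E.
    2:{ intros x y B; rewrite A by exact B; unfold one_peg; cbn [xorb].
        destruct ((x =? xf) && (y =? yf)) eqn:C; [| reflexivity].
        replace x with xf by lia; replace y with yf by lia; reflexivity. }
    rewrite total_flip, total_false in E by exact Bf; cbn [xorb] in E.
    rewrite <- E; symmetry.
    rewrite (total_ext n _
      (fun x y => xorb (weight k x y) ((x =? xs) && (y =? ys) && weight k xs ys))).
    2:{ intros x y B; unfold start_pos.
        destruct ((x =? xs) && (y =? ys)) eqn:C;
          [| cbn [negb andb]; rewrite xorb_false_r; reflexivity].
        replace x with xs by lia; replace y with ys by lia.
        cbn [negb andb]; rewrite xorb_nilpotent; reflexivity. }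
    rewrite total_flip by exact Bs; f_equal.
    unfold total; rewrite full_parity, Z2Nat.id by lia; reflexivity. }
  pose proof (K 0 ltac:(lia)) as K0; pose proof (K 1 ltac:(lia)) as K1;
    pose proof (K 2 ltac:(lia)) as K2; clear K.
  unfold weight in *; unfold necessary_condition.
  replace (xs + ys + xf + yf) with ((xs + ys) + (xf + yf)) by lia.
  rewrite (Z.add_mod (xs + ys) (xf + yf)) by lia.
  pose proof (Z.mod_pos_bound (xs + ys) 3); pose proof (Z.mod_pos_bound (xf + yf) 3).
  assert ((xs + ys) mod 3 = 0 \/ (xs + ys) mod 3 = 1 \/ (xs + ys) mod 3 = 2) as Hs by lia.
  assert ((xf + yf) mod 3 = 0 \/ (xf + yf) mod 3 = 1 \/ (xf + yf) mod 3 = 2) as Hf by lia.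
  destruct (n mod 3 =? 1) eqn:E, Hs as [Hs | [Hs | Hs]], Hf as [Hf | [Hf | Hf]];
    rewrite Hs, Hf in *; cbn in K0, K1, K2; try discriminate; cbn; lia.
Qed.

(** * Symmetries *)

Ltac split_ifs :=
  repeat (match goal with
          | |- context [if ?c then _ else _] => destruct c eqn:?
          end; try lia).

Ltac use_known :=
  match goal with
  | H : ?P ?a ?b = ?v |- context [?P ?x ?y] =>
      replace x with a by lia; replace y with b by lia; rewrite H; lia
  end.

(** A jump turns peg, peg, hole into hole, hole, peg. The complement of the result reads peg, peg,
    hole again, so the same jump leads to the complement of [P]. *)
Lemma jump_complement n P Q :
  jump n P Q -> reach n (fun x y => negb (Q x y)) (fun x y => negb (P x y)).
Proof.
  intros (x & y & dx & dy & D & B1 & B2 & B3 & E1 & E2 & E3 & ->).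
  assert (D0 : dx <> 0 \/ dy <> 0) by (unfold is_dir in D; lia).
  eapply reach_agree_r.
  - apply jump_reach; exists x, y, dx, dy.
    do 4 (split; [assumption |]).
    unfold upd; repeat split; split_ifs.
  - intros u v _; unfold upd.
    repeat match goal with
      |- context [if (?a =? ?b) && (?c =? ?d) then _ else _] =>
        destruct ((a =? b) && (c =? d)) eqn:?
      end; try lia.
    all: first [use_known | reflexivity].
Qed.

Lemma reach_complement n P Q :
  reach n P Q -> reach n (fun x y => negb (Q x y)) (fun x y => negb (P x y)).
Proof.
  intros (R & H & A).
  apply (reach_agree_l _ _ (fun x y => negb (R x y)));
    [intros x y B; rewrite (A x y B); reflexivity |].
  clear A; induction H as [P R J | P | P R S _ IH1 _ IH2].
  - apply jump_complement, J.
  - apply agree_reach, agree_refl.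
  - eapply reach_trans; eassumption.
Qed.

Lemma solvable_reverse n xs ys xf yf :
  solvable n xs ys xf yf -> solvable n xf yf xs ys.
Proof.
  rewrite !solvable_iff; intros H; apply reach_complement in H.
  eapply reach_agree_l; [| eapply reach_agree_r; [exact H |]].
  - intros x y _; reflexivity.
  - intros x y _; unfold start_pos, one_peg; lia.
Qed.

(** Positions are pulled back along the map; since it is an involution, this moves a single peg or
    hole to its image. In the third hypothesis [t = 1] and [t = 2] give the jumped cell and the
    target. *)
Lemma solvable_involution n (f g : Z -> Z -> Z) :
  (forall x y, f (f x y) (g x y) = x /\ g (f x y) (g x y) = y) ->
  (forall x y, in_board n x y -> in_board n (f x y) (g x y)) ->
  (forall dx dy, is_dir dx dy -> exists ex ey, is_dir ex ey /\
     forall x y t, f (x + t * dx) (y + t * dy) = f x y + t * ex /\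
                   g (x + t * dx) (y + t * dy) = g x y + t * ey) ->
  forall xs ys xf yf,
  solvable n xs ys xf yf -> solvable n (f xs ys) (g xs ys) (f xf yf) (g xf yf).
Proof.
  intros Hinv Hb Hd xs ys xf yf; rewrite !solvable_iff; intros H.
  assert (Hx : forall a b x y, (x =? f a b) && (y =? g a b) = (f x y =? a) && (g x y =? b)).
  { intros a b x y; apply eq_true_iff_eq.
    rewrite !andb_true_iff, !Z.eqb_eq; split; [intros [-> ->] | intros [<- <-]].
    - apply Hinv.
    - destruct (Hinv x y); auto. }
  apply (reach_map n n (fun P x y => P (f x y) (g x y))) in H.
  - eapply reach_agree_l; [| eapply reach_agree_r; [exact H |]].
    + intros x y _; unfold start_pos; rewrite Hx; reflexivity.
    + intros x y _; unfold one_peg; rewrite Hx; reflexivity.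
  - intros P Q A x y B; apply A, Hb, B.
  - clear - Hinv Hb Hd Hx.
    intros P Q (x & y & dx & dy & D & B1 & B2 & B3 & E1 & E2 & E3 & ->).
    destruct (Hd dx dy D) as (ex & ey & D' & Hl).
    pose proof (Hl x y 1) as [L1 L2]; pose proof (Hl x y 2) as [L3 L4].
    rewrite !Z.mul_1_l in L1, L2.
    eapply reach_agree_r.
    + apply jump_reach. exists (f x y), (g x y), ex, ey.
      rewrite <- L1, <- L2, <- L3, <- L4.
      split; [exact D' |].
      do 3 (split; [apply Hb; assumption |]).
      rewrite (proj1 (Hinv x y)), (proj2 (Hinv x y)).
      rewrite (proj1 (Hinv (x + dx) (y + dy))), (proj2 (Hinv (x + dx) (y + dy))).
      rewrite (proj1 (Hinv (x + 2 * dx) (y + 2 * dy))),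
              (proj2 (Hinv (x + 2 * dx) (y + 2 * dy))).
      split; [exact E1 |]. split; [exact E2 |]. split; [exact E3 |].
      reflexivity.
    + intros u v _; unfold upd. rewrite !Hx; reflexivity.
Qed.

Lemma solvable_mirror n xs ys xf yf :
  solvable n xs ys xf yf -> solvable n (ys - xs) ys (yf - xf) yf.
Proof.
  apply (solvable_involution n (fun x y => y - x) (fun _ y => y)).
  - lia.
  - unfold in_board; lia.
  - intros dx dy D; exists (dy - dx), dy; unfold is_dir in *; split; [lia | nia].
Qed.

(** The reflection exchanging the distances to the sides [x = 0] and [y = n - 1]. *)
Lemma solvable_swap n xs ys xf yf :
  solvable n xs ys xf yf ->
  solvable n (n - 1 - ys) (n - 1 - xs) (n - 1 - yf) (n - 1 - xf).
Proof.
  apply (solvable_involution n (fun _ y => n - 1 - y) (fun x _ => n - 1 - x)).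
  - lia.
  - unfold in_board; lia.
  - intros dx dy D; exists (- dy), (- dx); unfold is_dir in *; split; [lia | nia].
Qed.

Lemma condition_reverse n xs ys xf yf :
  necessary_condition n xs ys xf yf -> necessary_condition n xf yf xs ys.
Proof.
  unfold necessary_condition; intros [H1 H2]; split; intros Hn.
  - specialize (H1 Hn); Z.to_euclidean_division_equations; lia.
  - symmetry; auto.
Qed.

(** The new sum [2 * y - x] is congruent to [- (x + y)] modulo 3. *)
Lemma condition_mirror n xs ys xf yf :
  necessary_condition n xs ys xf yf ->
  necessary_condition n (ys - xs) ys (yf - xf) yf.
Proof.
  unfold necessary_condition; intros [H1 H2]; split; intros Hn.
  - specialize (H1 Hn); Z.to_euclidean_division_equations; lia.
  - specialize (H2 Hn); Z.to_euclidean_division_equations; lia.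
Qed.

(** The new sum is [2 * (n - 1) - (x + y)]; its constant vanishes modulo 3 if [n] is 1 modulo 3, and
    otherwise occurs on both sides. *)
Lemma condition_swap n xs ys xf yf :
  necessary_condition n xs ys xf yf ->
  necessary_condition n (n - 1 - ys) (n - 1 - xs) (n - 1 - yf) (n - 1 - xf).
Proof.
  unfold necessary_condition; intros [H1 H2]; split; intros Hn.
  - specialize (H1 Hn); Z.to_euclidean_division_equations; lia.
  - specialize (H2 Hn); Z.to_euclidean_division_equations; lia.
Qed.

(** * Clearing strips *)

Definition cut (m : Z) (P : position) : position := fun x y => (y <? m) && P x y.

Lemma reach_cut m n P Q : m <= n -> reach m P Q -> reach n (cut m P) (cut m Q).
Proof.
  intros Hmn; apply (reach_map m n (cut m)).
  - intros P' Q' A x y B; unfold cut.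
    destruct (y <? m) eqn:E; [| reflexivity].
    rewrite A; [reflexivity |]; unfold in_board in *; lia.
  - clear P Q; intros P Q (x & y & dx & dy & D & B1 & B2 & B3 & E1 & E2 & E3 & ->).
    unfold in_board in *.
    eapply reach_agree_r.
    + apply jump_reach; exists x, y, dx, dy; unfold cut.
      split; [exact D |]; unfold in_board; do 3 (split; [lia |]).
      rewrite E1, E2, E3; do 3 (split; [lia |]); reflexivity.
    + intros u v _; unfold upd, cut.
      repeat match goal with
        |- context [if (?a =? ?b) && (?c =? ?d) then _ else _] =>
          destruct ((a =? b) && (c =? d)) eqn:?
        end; lia.
Qed.

Definition strip (m a b : Z) (P : position) : position :=
  fun x y => if (m <=? y) && (y <? m + 3) then negb ((a <=? x) && (x <=? b)) else P x y.

Ltac solve_pos := split_ifs; try lia; try use_known; try reflexivity.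

Ltac play ox oy W0 ms :=
  let W := eval vm_compute in W0 in
  let R := eval vm_compute in (run W ms) in
  match R with
  | Some ?W' =>
      apply (replay _ ox oy W ms W');
      [ vm_compute; reflexivity
      | unfold in_board; repeat (apply Forall_cons || apply Forall_nil); (split; [lia |])
      | intros x y B; unfold in_board in B; unfold patch; cbn [look] ]
  end.

(** In row [m], the last full column before the gap has a peg on its left and a hole on its right.
    The three jumps remove the column and restore both. *)
Lemma sweep_left n m b P : m + 3 <= n -> forall k, 0 <= k ->
  2 + k <= b -> b <= m -> reach n (strip m (2 + k) b P) (strip m 2 b P).
Proof.
  intros Hn k Hk; revert k Hk.
  refine (natlike_ind _ _ _).
  - intros _ _; apply agree_reach, agree_refl.
  - intros k Hk IH H1 H2.
    eapply reach_trans; [| apply IH; lia].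
    play (2 + k) m
      [(-1,0,true); (0,0,true); (1,0,false); (0,1,true); (0,2,true)]
      [(-1,0,(1,0)); (0,2,(0,-1)); (1,0,(-1,0))];
      unfold strip.
    all: solve_pos.
Qed.

(** Columns 0 and 1 go together, as column 0 has no left neighbour to supply a peg. The peg at
    [(0, m - 1)] takes part and returns. *)
Lemma clear_left n m b P : m + 3 <= n -> 2 <= b -> b <= m ->
  P 0 (m - 1) = true -> reach n (strip m 2 b P) (strip m 0 b P).
Proof.
  intros Hn H2 Hb HP.
  play 0 m
    [(0,0,true); (1,0,true); (2,0,false); (0,2,true); (0,1,true); (0,-1,true);
     (1,2,true); (1,1,true)]
    [(0,0,(1,0)); (0,2,(0,-1)); (0,-1,(0,1)); (1,2,(0,-1)); (2,0,(-1,0)); (0,1,(0,-1))];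
    unfold strip; solve_pos.
Qed.

Lemma sweep_right n m a P : m + 3 <= n -> forall k, 0 <= k ->
  a <= m - 2 - k -> 0 <= a ->
  reach n (strip m a (m - 2 - k) P) (strip m a (m - 2) P).
Proof.
  intros Hn k Hk; revert k Hk.
  refine (natlike_ind _ _ _).
  - intros _ _; rewrite Z.sub_0_r; apply agree_reach, agree_refl.
  - intros k Hk IH H1 H2.
    eapply reach_trans; [| apply IH; lia].
    play (m - 2 - k) m
      [(-1,0,false); (0,0,true); (1,0,true); (0,1,true); (0,2,true)]
      [(1,0,(-1,0)); (0,2,(0,-1)); (-1,0,(1,0))];
      unfold strip; solve_pos.
Qed.

(** The slanted right end has nine pegs, in columns of lengths 3, 3, 2 and 1. Nine jumps remove
    them, and the peg at [(m - 1, m - 1)] takes part and returns. *)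
Lemma clear_right n m a P : m + 3 <= n -> 0 <= a -> a <= m - 2 ->
  P (m - 1) (m - 1) = true ->
  reach n (strip m a (m - 2) P) (strip m a (m + 2) P).
Proof.
  intros Hn H0 Ha HP.
  play m m
    [(0,0,true); (-1,0,true); (-2,0,false); (-1,2,true); (-1,1,true); (-1,-1,true);
     (1,2,true); (0,2,true); (0,1,true); (1,1,true); (2,2,true)]
    [(0,0,(-1,0)); (-1,2,(0,-1)); (-1,-1,(0,1)); (1,2,(-1,0)); (-2,0,(1,1));
     (-1,2,(1,0)); (2,2,(-1,0)); (0,2,(0,-1)); (1,1,(-1,-1))];
    unfold strip; solve_pos.
Qed.

Lemma strip_clear n m a b P :
  m + 3 <= n -> 2 <= a \/ a = 0 -> a <= b -> b <= m - 2 ->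
  (2 <= a -> P 0 (m - 1) = true) -> P (m - 1) (m - 1) = true ->
  reach n (strip m a b P) (strip m 0 (m + 2) P).
Proof.
  intros Hn Ha Hab Hb HL HR.
  apply (reach_trans _ _ (strip m 0 b P)).
  - destruct Ha as [Ha | ->]; [| apply agree_reach, agree_refl].
    apply (reach_trans _ _ (strip m 2 b P)); [| apply clear_left; auto; lia].
    replace a with (2 + (a - 2)) by lia; apply sweep_left; lia.
  - apply (reach_trans _ _ (strip m 0 (m - 2) P)); [| apply clear_right; auto; lia].
    replace b with (m - 2 - (m - 2 - b)) by lia; apply sweep_right; lia.
Qed.

Definition full_below (n m : Z) (P : position) : Prop :=
  forall x y, in_board n x y -> m <= y -> P x y = true.

(** The exchange of [sweep_left] along a diagonal: the hole [(h, m - 1)] and the peg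
    [(h + 2, m + 1)] face each other across the top of column [h + 1]. *)
Lemma open_strip n m h P :
  m + 3 <= n -> 1 <= h -> h <= m - 3 -> full_below n m P -> P h (m - 1) = false ->
  reach n P (strip m (h + 1) (h + 1) P).
Proof.
  intros Hn H1 H3 HF HP.
  play h m
    [(2,1,true); (1,0,true); (0,-1,false); (1,2,true); (1,1,true)]
    [(2,1,(-1,-1)); (1,2,(0,-1)); (0,-1,(1,1))].
  all: try (apply HF; [unfold in_board |]; lia).
  1: replace (h + 0) with h by lia; exact HP.
  unfold strip; split_ifs; try use_known.
  all: first [reflexivity | rewrite HF by (unfold in_board; lia); lia].
Qed.

(** The rows from [m + 3] on have to be removed first, through the hole at the bottom of the
    empty columns: clearing the ends of a strip needs the corner pegs just above it. *)
Lemma clear_below (j : nat) : forall n m a b P,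
  n = m + 3 + 3 * Z.of_nat j -> 2 <= a -> a <= b -> b <= m - 2 ->
  P 0 (m - 1) = true -> P (m - 1) (m - 1) = true -> full_below n (m + 3) P ->
  reach n (strip m a b P) (cut m P).
Proof.
  induction j as [|j IH]; intros n m a b P Hn Ha Hab Hb HL HR HF.
  - eapply reach_agree_r; [apply strip_clear; auto; lia |].
    intros x y B; unfold in_board, strip, cut in *; split_ifs.
  - eapply (reach_trans _ _ (strip (m + 3) (b + 1) (b + 1) (strip m a b P))).
    + apply open_strip; try lia.
      * intros x y B Hy; unfold strip; split_ifs; apply HF; auto.
      * unfold strip; split_ifs.
    (* Both ends of row [m + 2] still hold pegs, since [2 <= a] and [b <= m - 2]. *)
    + eapply reach_trans; [apply IH; try lia |].
      * unfold strip; split_ifs.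
      * unfold strip; split_ifs.
      * intros x y B Hy; unfold strip; split_ifs; apply HF; auto; lia.
      * eapply reach_agree_l;
          [| eapply reach_agree_r;
             [apply (strip_clear n m a b (cut (m + 3) P)); auto; try lia |]].
        -- intros x y B; unfold in_board, strip, cut in *; split_ifs.
        -- intros _; unfold cut; rewrite HL; lia.
        -- unfold cut; rewrite HR; lia.
        -- intros x y B; unfold in_board, strip, cut in *; split_ifs.
Qed.

Lemma clear_below_hole (j : nat) n m h P :
  n = m + 3 + 3 * Z.of_nat j -> 1 <= h -> h <= m - 3 -> P h (m - 1) = false ->
  P 0 (m - 1) = true -> P (m - 1) (m - 1) = true -> full_below n m P ->
  reach n P (cut m P).
Proof.
  intros Hn H1 H3 HP HL HR HF.
  eapply reach_trans; [apply (open_strip n m h P); auto; lia |].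
  apply (clear_below j); auto; try lia.
  intros x y B Hy; apply HF; auto; lia.
Qed.

Definition cell_eq_dec (c d : Z * Z) : {c = d} + {c <> d}.
Proof. decide equality; apply Z.eq_dec. Defined.

Definition full_but (hx hy : Z) (ms : list move) : window :=
  map (fun '(x, y) => (x, y, negb ((x =? hx) && (y =? hy))))
    (nodup cell_eq_dec
       (flat_map (fun '(x, y, (dx, dy)) =>
          [(x, y); (x + dx, y + dy); (x + (dx + dx), y + (dy + dy))]) ms)).

Ltac row_cases y m :=
  let H := fresh in
  assert (y < m - 3 \/ y = m + -3 \/ y = m + -2 \/ y = m + -1 \/
          y = m + 0 \/ y = m + 1 \/ y = m + 2 \/ m + 2 < y) as H by lia;
  destruct H as [H | [H | [H | [H | [H | [H | [H | H]]]]]]];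
  try subst y;
  repeat match goal with
    | |- context [m + ?k - m] => replace (m + k - m) with k by lia
    | |- context [?y - m =? ?k] => replace (y - m =? k) with false by lia
    end;
  cbn [Z.eqb Pos.eqb]; rewrite ?andb_true_r, ?andb_false_r; cbv iota.

(** The rows [r] and [y] are relative to [m], the columns [a], [b] and [x] to the column [X] of the
    initial hole. *)
Ltac start_with r a b x y ms :=
  match goal with
  | |- exists _ _ _ _, in_board ?m _ _ /\ (_ mod _ = (?X + _) mod _) /\ _ =>
      exists (X + a), (X + b), (X + x), (m + y);
      unfold in_board;
      split; [lia |];
      split; [Z.to_euclidean_division_equations; lia |];
      do 4 (split; [lia |]);
      play X m (full_but 0 r ms) ms; unfold start_pos, strip;
      [lia .. | match goal with |- _ = if (m <=? ?y) && _ then _ else _ => row_cases y m end;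
        split_ifs]
  end.

(** The jumps were found by computer search among those that stay within the six rows
    [m - 3], ..., [m + 2]. *)
Lemma open_start n m xs ys :
  6 <= m -> m + 3 <= n -> 0 <= xs -> 2 * xs <= ys -> m - 3 <= ys -> ys < m + 3 ->
  exists a b x y,
    in_board m x y /\ (x + y) mod 3 = (xs + ys) mod 3 /\ x + y <> 2 * (m - 1) /\
    a <= b /\ b <= m - 2 /\ (2 <= a /\ x + (m - y) <> 1 \/ a = 0 /\ m <= ys) /\
    reach n (start_pos xs ys) (strip m a b (start_pos x y)).
Proof.
  intros Hm Hn H0 Hx H1 H2.
  assert (ys = m + -3 \/ ys = m + -2 \/ ys = m + -1 \/ ys = m + 0 \/ ys = m + 1 \/ ys = m + 2)
    as Hr by lia.
  destruct Hr as [-> | [-> | [-> | [-> | [-> | ->]]]]].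
  - destruct (Z.le_gt_cases xs 1).
    + start_with (-3) (2) (3) (1) (-1)
        [(0,-1,(0,-1)); (2,0,(-1,-1)); (2,1,(-1,-1)); (4,2,(-1,-1));
         (2,2,(1,0)); (3,0,(-1,0))].
    + start_with (-3) (0) (1) (1) (-1)
        [(0,-1,(0,-1)); (0,1,(0,-1)); (2,0,(-1,-1)); (2,2,(-1,-1));
         (0,0,(1,0)); (0,2,(1,0))].
  - assert (xs = 0 \/ xs = 1 \/ 2 <= xs) as [-> | [-> | ?]] by lia.
    + start_with (-2) (2) (3) (2) (-1)
        [(2,-2,(-1,0)); (2,0,(0,-1)); (4,2,(-1,-1)); (2,1,(0,-1));
         (2,2,(1,0)); (3,0,(-1,-1))].
    + start_with (-2) (1) (2) (2) (-1)
        [(0,0,(0,-1)); (0,2,(0,-1)); (2,1,(-1,0)); (2,-1,(0,1)); (2,1,(-1,-1));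
         (2,2,(-1,0))].
    + start_with (-2) (0) (1) (2) (-1)
        [(0,0,(0,-1)); (0,2,(0,-1)); (2,1,(-1,-1)); (1,2,(0,-1)); (2,-1,(0,1)); (0,0,(1,0))].
  - assert (xs = 0 \/ 1 <= xs) as [-> | ?] by lia.
    + start_with (-1) (2) (3) (3) (-1)
        [(2,-1,(-1,0)); (2,1,(0,-1)); (4,2,(-1,-1)); (2,2,(1,0));
         (3,-1,(0,1)); (3,1,(-1,-1))].
    (* These are the jumps of [open_strip]; the hole stays where it is. *)
    + start_with (-1) (1) (1) (0) (-1)
        [(2,1,(-1,-1)); (1,2,(0,-1)); (0,-1,(1,1))].
  - destruct (Z.le_gt_cases xs 2).
    + start_with (0) (2) (2) (1) (-1)
        [(2,2,(-1,-1)); (3,1,(-1,0)); (1,-1,(1,1))].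
    + start_with (0) (0) (1) (1) (-1)
        [(0,-2,(0,1)); (0,1,(0,-1)); (2,0,(-1,-1)); (2,2,(-1,-1)); (0,0,(1,0)); (0,2,(1,0))].
  - assert (xs = 0 \/ xs = 1 \/ 2 <= xs) as [-> | [-> | ?]] by lia.
    (* The only case with [a = 0], where the gap begins at the left side. *)
    + start_with (1) (0) (1) (2) (-1)
        [(0,-1,(0,1)); (0,2,(0,-1)); (2,1,(-1,-1)); (1,2,(0,-1)); (2,-1,(0,1)); (0,0,(1,0))].
    + start_with (1) (1) (2) (2) (-1)
        [(0,-1,(0,1)); (0,2,(0,-1)); (2,1,(-1,0)); (2,-1,(0,1)); (2,1,(-1,-1));
         (2,2,(-1,0))].
    + start_with (1) (0) (1) (-1) (-1)
        [(0,-1,(0,1)); (2,1,(-1,-1)); (2,2,(-1,-1)); (-1,-1,(1,1));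
         (0,1,(1,0)); (0,2,(1,0))].
  - assert (xs = 0 \/ (xs = 1 \/ xs = 2) \/ 3 <= xs) as [-> | [? | ?]] by lia.
    + start_with (2) (2) (3) (3) (-1)
        [(2,2,(-1,0)); (1,0,(0,1)); (3,0,(-1,0)); (3,2,(0,-1)); (3,-1,(0,1)); (3,1,(-1,0))].
    + start_with (2) (1) (2) (0) (-1)
        [(0,0,(0,1)); (2,0,(-1,0)); (0,-1,(0,1)); (0,2,(0,-1)); (2,1,(-1,0)); (2,2,(-1,0))].
    + start_with (2) (-1) (0) (0) (-1)
        [(2,2,(-1,0)); (-1,0,(1,1)); (-1,2,(0,-1)); (0,-1,(0,1)); (0,2,(1,0)); (-1,0,(1,1))].
Qed.

(** * Small boards *)

Definition cells (m : nat) : list (Z * Z) :=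
  flat_map (fun y => map (fun x => (Z.of_nat x, Z.of_nat y)) (seq 0 (S y))) (seq 0 m).

Definition directions : list (Z * Z) := [(1,0); (-1,0); (0,1); (0,-1); (1,1); (-1,-1)].

(** A solution is encoded in base 256, least significant digit first; the digit
    [6 i + d] is the jump of the peg in the [i]-th cell in the [d]-th direction.
    The digit [0] would jump off the board and so marks the end. *)
Fixpoint decode (fuel m : nat) (z : Z) : list move :=
  match fuel with
  | O => []
  | S fuel' =>
      if z =? 0 then [] else
      let c := z mod 256 in
      (nth (Z.to_nat (c / 6)) (cells m) (0, 0),
       nth (Z.to_nat (c mod 6)) directions (0, 0)) :: decode fuel' m (z / 256)
  end.

Definition all_but (m : nat) (c : Z * Z) : window :=
  map (fun '(x, y) => (x, y, negb ((x =? fst c) && (y =? snd c)))) (cells m).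

(** The background of a window on a small board: the additional rows of a larger board are full. *)
Definition full_position : position := fun _ _ => true.

(** Tests the conditions on row [m - 1] in [clear_below_hole]; there [h] ranges from 1 to
    [m - 3]. *)
Definition openable (m : Z) (W : window) : bool :=
  match look W 0 (m - 1), look W (m - 1) (m - 1) with
  | Some true, Some true =>
      existsb (fun h => match look W (Z.of_nat h) (m - 1) with
                        | Some v => negb v | None => false end)
        (seq 1 (Z.to_nat m - 3))
  | _, _ => false
  end.

Fixpoint opens (m : Z) (W : window) (ms : list move) : bool :=
  openable m W ||
  match ms with
  | [] => false
  | mv :: ms' => match step W mv with Some W' => opens m W' ms' | None => false end
  end.

Definition single (m : nat) (W : window) (f : Z * Z) : bool :=
  forallb (fun '(x, y) => match look W x y with
                          | Some v => eqb v ((x =? fst f) && (y =? snd f))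
                          | None => false end) (cells m).

(** The flag tells whether the solution passes through an openable position; the list is
    empty for an invalid code. *)
Definition outcome (m : nat) (z : Z) : list (Z * Z * (Z * Z) * bool) :=
  (* A solution of the board of size 8 has 34 jumps, so this fuel is ample. *)
  match decode 50 m z with
  | [] => []
  | (x, y, (dx, dy)) as mv :: ms =>
      (* The first jump lands in the only hole, so the code need not record the start. *)
      let s := (x + (dx + dx), y + (dy + dy)) in
      match run (all_but m s) (mv :: ms) with
      | None => []
      | Some W =>
          match filter snd W with
          | (f, _) :: _ =>
              if single m W f && existsb (fun c => (fst c =? fst f) && (snd c =? snd f)) (cells m)
              then [(s, f, opens (Z.of_nat m) (all_but m s) (mv :: ms))]
              else []
          | [] => []
          end
      end
  end.

Lemma cells_in m x y : In (x, y) (cells m) <-> in_board (Z.of_nat m) x y.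
Proof.
  unfold cells, in_board; rewrite in_flat_map; split.
  - intros (v & Hv & H); apply in_map_iff in H as (u & [= <- <-] & Hu).
    apply in_seq in Hv, Hu; lia.
  - intros H; exists (Z.to_nat y); split; [apply in_seq; lia |].
    apply in_map_iff; exists (Z.to_nat x); split; [f_equal; lia | apply in_seq; lia].
Qed.

Lemma all_but_inside m c : inside (Z.of_nat m) 0 0 (all_but m c).
Proof.
  unfold inside, all_but; rewrite Forall_map, Forall_forall.
  intros [x y] H; apply cells_in, H.
Qed.

Lemma look_map_cells (F : Z -> Z -> bool) L x y :
  look (map (fun '(x, y) => (x, y, F x y)) L) x y = Some (F x y) \/
  look (map (fun '(x, y) => (x, y, F x y)) L) x y = None /\ ~ In (x, y) L.
Proof.
  induction L as [|[a b] L IH]; simpl; [auto |].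
  destruct ((x =? a) && (y =? b)) eqn:E.
  - left; replace a with x by lia; replace b with y by lia; reflexivity.
  - destruct IH as [IH | [IH N]]; [auto | right].
    split; [exact IH |]; intros [[= -> ->] | H]; [lia | auto].
Qed.

Lemma all_but_start m xs ys n : in_board (Z.of_nat m) xs ys ->
  agree n (start_pos xs ys) (patch 0 0 (all_but m (xs, ys)) full_position).
Proof.
  intros B x y _; unfold patch, start_pos, all_but; rewrite !Z.sub_0_r; simpl fst; simpl snd.
  destruct (look_map_cells (fun x y => negb ((x =? xs) && (y =? ys))) (cells m) x y)
    as [-> | [-> N]]; [reflexivity |].
  destruct ((x =? xs) && (y =? ys)) eqn:E; [| reflexivity].
  exfalso; apply N; replace x with xs by lia; replace y with ys by lia.
  apply cells_in, B.
Qed.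

Lemma inside_mono m n W : m <= n -> inside m 0 0 W -> inside n 0 0 W.
Proof.
  intros H; apply Forall_impl; intros [[x y] v]; unfold in_board; lia.
Qed.

Lemma openable_reach (j : nat) m n W : n = m + 3 + 3 * Z.of_nat j ->
  inside m 0 0 W -> openable m W = true ->
  reach n (patch 0 0 W full_position) (cut m (patch 0 0 W full_position)).
Proof.
  intros Hn B; unfold openable.
  destruct (look W 0 (m - 1)) as [[|]|] eqn:E1; try discriminate.
  destruct (look W (m - 1) (m - 1)) as [[|]|] eqn:E2; try discriminate.
  intros H; apply existsb_exists in H as (h & Hh & H); apply in_seq in Hh.
  destruct (look W (Z.of_nat h) (m - 1)) as [[|]|] eqn:E3; try discriminate.
  apply (clear_below_hole j n m (Z.of_nat h)); try lia.
  - exact (patch_at 0 0 W full_position _ _ _ E3).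
  - exact (patch_at 0 0 W full_position _ _ _ E1).
  - exact (patch_at 0 0 W full_position _ _ _ E2).
  - intros x y _ Hy; unfold patch; rewrite !Z.sub_0_r.
    destruct (look W x y) as [v|] eqn:E; [| reflexivity].
    apply (look_inside _ _ _ _ _ _ _ B) in E; unfold in_board in E; lia.
Qed.

(** The jumps up to the first openable position are played above full lower rows; then these rows
    are removed, and [reach_cut] transfers the remaining jumps. *)
Lemma opens_reach (j : nat) m n : n = m + 3 + 3 * Z.of_nat j ->
  forall ms W W', inside m 0 0 W -> opens m W ms = true -> run W ms = Some W' ->
  reach n (patch 0 0 W full_position) (cut m (patch 0 0 W' full_position)).
Proof.
  intros Hn; induction ms as [|mv ms IH]; intros W W' B; cbn [opens run];
    (destruct (openable m W) eqn:O; simpl orb;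
     [intros _ H; eapply reach_trans; [apply (openable_reach j m); assumption |] |]).
  - injection H as <-; apply agree_reach, agree_refl.
  - discriminate.
  - apply reach_cut; [lia |].
    exact (proj1 (run_reach _ _ _ (mv :: ms) _ _ _ B H)).
  - destruct (step W mv) as [V|] eqn:E; [| discriminate]; intros H1 H2.
    destruct (step_reach n 0 0 W mv V full_position) as [R _];
      [apply (inside_mono m); [lia | exact B] | exact E |].
    eapply reach_trans; [exact R |].
    apply IH; auto.
    apply (step_reach m 0 0 W mv V full_position B E).
Qed.

Lemma outcome_sound m z xs ys xf yf o :
  In (xs, ys, (xf, yf), o) (outcome m z) ->
  solvable (Z.of_nat m) xs ys xf yf /\
  (o = true -> forall j : nat, solvable (Z.of_nat m + 3 + 3 * Z.of_nat j) xs ys xf yf).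
Proof.
  unfold outcome.
  destruct (decode 50 m z) as [|[[x y] [dx dy]] ms']; [intros [] |].
  cbv zeta; set (ms := @cons move (x, y, (dx, dy)) ms').
  destruct (run (all_but m (x + (dx + dx), y + (dy + dy))) ms) as [W|] eqn:R; [| intros []].
  destruct (filter snd W) as [|[[u v] w] L]; [intros [] |].
  destruct (single m W (u, v)) eqn:Hs; [| intros []].
  destruct (existsb (fun c => (fst c =? u) && (snd c =? v)) (cells m)) eqn:Hf;
    cbn [fst snd andb]; [| rewrite Hf; intros []].
  (* The first jump succeeds, so its target is listed in the window and lies on the board. *)
  assert (Bs : in_board (Z.of_nat m) (x + (dx + dx)) (y + (dy + dy))).
  { unfold ms in R; cbn [run] in R.
    destruct (step (all_but m (x + (dx + dx), y + (dy + dy))) (x, y, (dx, dy))) as [V|] eqn:E; [| discriminate].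
    unfold step in E.
    destruct (dirb dx dy); [| discriminate].
    destruct (look (all_but m (x + (dx + dx), y + (dy + dy))) x y) as [[|]|]; try discriminate.
    destruct (look (all_but m (x + (dx + dx), y + (dy + dy))) (x + dx) (y + dy)) as [[|]|]; try discriminate.
    destruct (look (all_but m (x + (dx + dx), y + (dy + dy))) (x + (dx + dx)) (y + (dy + dy))) as [[|]|] eqn:E3; try discriminate.
    apply (look_inside (Z.of_nat m) 0 0) in E3; [exact E3 | apply all_but_inside]. }
  rewrite Hf; intros [[= <- <- <- <- <-] | []].
  apply existsb_exists in Hf as ([a b] & Hab & Hf); apply cells_in in Hab.
  simpl in Hf; replace a with u in Hab by lia; replace b with v in Hab by lia; clear a b Hf.
  assert (F : agree (Z.of_nat m) (patch 0 0 W full_position) (one_peg u v)).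
  { intros a b B; apply cells_in in B.
    unfold single in Hs; rewrite forallb_forall in Hs; specialize (Hs _ B).
    unfold patch, one_peg; rewrite !Z.sub_0_r; simpl in Hs.
    destruct (look W a b); [apply eqb_prop, Hs | discriminate]. }
  split; [| intros O j]; apply solvable_iff;
    (eapply reach_agree_l; [apply (all_but_start m); exact Bs |]).
  - eapply reach_agree_r; [| exact F].
    exact (proj1 (run_reach _ _ _ ms _ _ _ (all_but_inside m _) R)).
  - eapply reach_agree_r; [apply (opens_reach j (Z.of_nat m) _ eq_refl ms);
      [apply all_but_inside | exact O | exact R] |].
    intros a b B; unfold cut.
    destruct (b <? Z.of_nat m) eqn:E.
    + apply F; unfold in_board in *; lia.
    + unfold one_peg; unfold in_board in *; lia.
Qed.

(** Words in two reflections that generate the symmetry group: [true] is the mirror, [false] the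
    swap, and the last letter acts first. *)
Fixpoint act (m : nat) (w : list bool) (c : Z * Z) : Z * Z :=
  match w with
  | [] => c
  | true :: w' => let '(x, y) := act m w' c in (y - x, y)
  | false :: w' => let '(x, y) := act m w' c in (Z.of_nat m - 1 - y, Z.of_nat m - 1 - x)
  end.

Lemma act_solvable m w : forall xs ys xf yf,
  solvable (Z.of_nat m) (fst (act m w (xs, ys))) (snd (act m w (xs, ys)))
    (fst (act m w (xf, yf))) (snd (act m w (xf, yf))) ->
  solvable (Z.of_nat m) xs ys xf yf.
Proof.
  induction w as [|[|] w IH]; intros xs ys xf yf; [exact (fun H => H) | |];
    intros H; apply IH; revert H; cbn [act];
    destruct (act m w (xs, ys)) as [a b], (act m w (xf, yf)) as [c d]; simpl fst; simpl snd;
    intros H.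
  - apply solvable_mirror in H.
    replace (b - (b - a)) with a in H by lia; replace (d - (d - c)) with c in H by lia.
    exact H.
  - apply solvable_swap in H.
    set (k := Z.of_nat m) in *.
    replace (k - 1 - (k - 1 - a)) with a in H by lia.
    replace (k - 1 - (k - 1 - b)) with b in H by lia.
    replace (k - 1 - (k - 1 - c)) with c in H by lia.
    replace (k - 1 - (k - 1 - d)) with d in H by lia.
    exact H.
Qed.

Definition conditionb (m xs ys xf yf : Z) : bool :=
  if m mod 3 =? 1 then negb ((xs + ys) mod 3 =? 0) && ((xs + ys + xf + yf) mod 3 =? 0)
  else (xs + ys) mod 3 =? (xf + yf) mod 3.

Lemma conditionb_true m xs ys xf yf :
  necessary_condition m xs ys xf yf -> conditionb m xs ys xf yf = true.
Proof.
  unfold necessary_condition, conditionb; intros [H1 H2].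
  destruct (m mod 3 =? 1) eqn:E; lia.
Qed.

Definition same (c d : Z * Z) : bool := (fst c =? fst d) && (snd c =? snd d).

Lemma same_eq c d : same c d = true -> c = d.
Proof. destruct c, d; unfold same; simpl; intros H; f_equal; lia. Qed.

(** The six elements of the symmetry group of the triangle, as reduced words. *)
Definition symmetries : list (list bool) :=
  [[]; [true]; [false]; [true; false]; [false; true]; [true; false; true]].

Definition covers (m : nat) (codes : list Z) : bool :=
  let R := flat_map (outcome m) codes in
  forallb (fun s => forallb (fun f =>
    implb (conditionb (Z.of_nat m) (fst s) (snd s) (fst f) (snd f))
      (existsb (fun w => let s' := act m w s in let f' := act m w f in
         existsb (fun '(a, b, _) => (same s' a && same f' b) || (same f' a && same s' b)) R)
       symmetries)) (cells m)) (cells m).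

(** The cells whose distances to the two sides meeting in the top corner are at most 2. *)
Definition corner : list (Z * Z) :=
  [(0,0); (0,1); (0,2); (1,1); (1,2); (1,3); (2,2); (2,3); (2,4)].

(** Only the mirror is used, since the other symmetries of the small board do not extend to the
    larger board with rows added below. *)
Definition covers_corner (m : nat) (codes : list Z) : bool :=
  let R := flat_map (outcome m) codes in
  forallb (fun s => forallb (fun f =>
    implb (conditionb (Z.of_nat m) (fst s) (snd s) (fst f) (snd f))
      (existsb (fun w => let s' := act m w s in let f' := act m w f in
         existsb (fun '(a, b, o) => o &&
           ((same s' a && same f' b) || (same f' a && same s' b))) R)
       [[]; [true]])) corner) corner.

Lemma covers_sound m codes : covers m codes = true ->
  forall xs ys xf yf, in_board (Z.of_nat m) xs ys -> in_board (Z.of_nat m) xf yf ->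
  necessary_condition (Z.of_nat m) xs ys xf yf -> solvable (Z.of_nat m) xs ys xf yf.
Proof.
  unfold covers; intros H xs ys xf yf Bs Bf C.
  apply cells_in in Bs, Bf; apply conditionb_true in C.
  rewrite forallb_forall in H; specialize (H _ Bs).
  rewrite forallb_forall in H; specialize (H _ Bf).
  cbn [fst snd] in H; rewrite C in H; cbn [implb] in H.
  apply existsb_exists in H as (w & _ & H).
  apply existsb_exists in H as ([[[a b] [c d]] o] & HR & H).
  apply in_flat_map in HR as (z & _ & HR).
  apply outcome_sound in HR as [HR _].
  apply (act_solvable m w).
  apply orb_prop in H as [H | H]; apply andb_prop in H as [H1 H2];
    apply same_eq in H1, H2; rewrite H1, H2; [exact HR | apply solvable_reverse, HR].
Qed.

Lemma covers_corner_sound m codes : covers_corner m codes = true ->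
  forall (j : nat) xs ys xf yf,
  0 <= xs -> xs <= 2 -> 0 <= ys - xs -> ys - xs <= 2 ->
  0 <= xf -> xf <= 2 -> 0 <= yf - xf -> yf - xf <= 2 ->
  necessary_condition (Z.of_nat m) xs ys xf yf ->
  solvable (Z.of_nat m + 3 + 3 * Z.of_nat j) xs ys xf yf.
Proof.
  intros H j.
  assert (K : forall x y, 0 <= x -> x <= 2 -> 0 <= y - x -> y - x <= 2 -> In (x, y) corner).
  { intros x y H1 H2 H3 H4.
    assert (x = 0 \/ x = 1 \/ x = 2) as Hx by lia.
    assert (y - x = 0 \/ y - x = 1 \/ y - x = 2) as Hy by lia.
    destruct Hx as [-> | [-> | ->]], Hy as [Hy | [Hy | Hy]]; simpl;
      repeat ((left; f_equal; lia) || right). }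
  intros xs ys xf yf S1 S2 S3 S4 F1 F2 F3 F4 C; apply conditionb_true in C.
  unfold covers_corner in H.
  rewrite forallb_forall in H; specialize (H _ (K _ _ S1 S2 S3 S4)).
  rewrite forallb_forall in H; specialize (H _ (K _ _ F1 F2 F3 F4)).
  cbn [fst snd] in H; rewrite C in H; cbn [implb] in H.
  apply existsb_exists in H as (w & Hw & H).
  apply existsb_exists in H as ([[[a b] [c d]] o] & HR & H).
  apply in_flat_map in HR as (z & _ & HR).
  apply andb_prop in H as [-> H].
  apply outcome_sound in HR as [_ HR]; specialize (HR eq_refl j).
  assert (D : solvable (Z.of_nat m + 3 + 3 * Z.of_nat j)
    (fst (act m w (xs, ys))) (snd (act m w (xs, ys)))
    (fst (act m w (xf, yf))) (snd (act m w (xf, yf)))).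
  { apply orb_prop in H as [H | H]; apply andb_prop in H as [H1 H2];
    apply same_eq in H1, H2; rewrite H1, H2; [exact HR | apply solvable_reverse, HR]. }
  destruct Hw as [<- | [<- | []]]; [exact D |].
  apply solvable_mirror in D; cbn [act fst snd] in D.
  replace (ys - (ys - xs)) with xs in D by lia; replace (yf - (yf - xf)) with xf in D by lia.
  exact D.
Qed.

Definition solutions6 : list Z :=
  [ 0x1535690216371059246f3b5a796b713f164b23;
    0x536928201a7104083f1679693b5a6d632a5923;
    0x16634f1c6d3f457708377d245a206937042d23;
    0x271f53427704201a6608635924795d71204d27;
    0x43b1245711a23027955711660326d3f5a6b27;
    0x3724086f423f20693716045a771f7d37693127;
    0x2274d0e08204d3c14695a592071796677313f;
    0x2471551c7722425316690e7d0216375a69313f;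
    0x532471163710022d59106071165d7971243745;
    0x1671553f22316073427d140a375d2404206953;
    0x7160282008042d3f6937161073386d7d5a6937;
    0x16634f1c6d3f45552212105a59796920710216;
    0x317116695a383c1c7124200479692071554d15;
    0x6d284f205d0a604227733866790216712a5923;
    0x14310a5363245d71201a695920797145041f27;
    0x4216717902233a356679164f5a026d265a6b27;
    0x284f1c55695d452273670e147d5d0216374d27;
    0x1a376953165a3f716b160a10597971204d2702;
    0x60326d793a24636f1c227d165d480227592302 ].

Definition solutions7 : list Z :=
  [ 0x3b4b100a3c4b143b04556920934f3c4d8497a7569d917e8f5d27;
    0x2234b3b27043c1f08249563314f81843ca1717d3890a39b4d27;
    0x691637240e3255426f3b9545041f083f8497a7569d917e8f5d27;
    0x1202276b3223590224204f631695712ca78497569d915d7e8f3f;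
    0x7138101220423f0824596f953b042084495d97a7569d917e8f3f;
    0x691637240e3255427720954202169d4f5d2887917ea78d425571;
    0x4f16713f168f427e3e917e8d38711a79103a9d93a755326b0227;
    0x227d993a34a399937d3869160e4d3c328d718781162649025d27;
    0x672c4f3c81938b268132675d380a27109d935502a73a79713127;
    0x382a69a1207190593c2e6f227d84a39781265a8d043b0e084d27;
    0x97844a285d8a9b4f671c813c244f374510a35908997d3b041f27;
    0x9056a79d3a8a4a9b328d487d223c8742558126084d04141f5d27;
    0x81268f4a163e328d717e910a2c38879b4253a31059997d3b041f;
    0x932e559d4c2290794693550e2ea39b32849528083f81675d2702;
    0x284f8d5d3267932c878126389b495d1012a33b7d995902232702;
    0x8a4a559d42a76c38937d2048595a84952681081f4527041f083f;
    0x4f16713f168f42955d28206937552e9d7e8a9b021210a73a7971;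
    0x387d6c2e63939d95a75542204f288495083f813c2e043b0e1671 ].

Definition solutions8 : list Z :=
  [ 0x2312533b0a04451c712420797160555d4d27c373a38d7eb4c7d3cb71a8b4c58d4d15;
    0x5324370824101c693c32596f3b049960937d3b81bf40b7c7a8bbb1606fd3c9a75923;
    0x9b6032771c662c778a4014c35622b45e7dc737bf40aebf0216ab5a69d3cba39b4b23;
    0x270223124d3b045542204f63169966794c5dc356b795a8b47ec7bf63d3cba39b4d27;
    0x596f2204151f2a59270269207971165a6b26cba371d3bfc7b4c560a89b81b95d4d27;
    0x7138101220423f16697334958444793ac56602b479c770a8b4c781d77acdc1b95d27;
    0x1f530a45350415693f3b045a20711695427950bdb77e8dc771a8b4c356d3cba39b4d;
    0x6920596f243208220e3f6b278f97560216c3794cb7cb66a35dd3cb73a8bbb167813f;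
    0x5324370824101c693c32596f3b0460937720c3a37971b4c7bf8140a8b7d3cb6d8745;
    0x9b6032771c66457737245d141f7d370824b9bf40c7bf042081d140d779a871b79545;
    0x7138101220423f08248d4b3b045a6f9756229d8a7e8dc356b4a8c7b4a7d3c356cb71;
    0x8d281a534a93387346c38a40740e7d2216bf5a4aa3c7b4c30256a8b77e8dd3cb7116;
    0x6b4f163f1c71455a081f14953c4f04b746a83bbd7e9bb76956a7d1c0d3cb569b4b23;
    0xbf4a28ae5d62952c8f26a85cbb9b5648a8c7b4c30e3b1679710216d1d779712a5923;
    0x8b4ab73c4a5aa8bf6781163fc54a9bb74f4656cb932012227d04d12277d77d374d15;
    0x4673cb954cbacb846eb444d1527ac7b140bf1c5a556922d77d1637ab02145d244b23;
    0xa862914ab7b15c9bc144b93eab2e6d5a79c9663752d17d24d7793708242071042d23;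
    0x81268f4a163e328d497eb76d40a8bdb79b69562204c3200a53a358cdd779c3736935;
    0x932e9b384c209d794cc35660902866a374bf0e16c740d3b4c7bf027ea8b74a8f5d27;
    0xb7402c8f976d5e4f44bf40aebf87372c1440c77dbf2256d1ab5ad7799b0e02693127;
    0xd758c952d1997c3a4c907ac0d320602c71b4c787bf44042d5e23abb53eab14025d27;
    0x91406db78160b126445ebba873c34ab71a53465622cb937d080422d77dd177372435;
    0x566679c3cd73bd667648d3c7b43aa764c12c1c5540b74a145dabb18f02275d230227;
    0xc76a5ab946c1b7976d4f44b15a8dab56d19932245d377dd7227d160a376904204d27;
    0xc06a5079d193d77950c560bf329b42551a69374540aebf870e2420495dab14025d27;
    0x95b75e26495d67501a145d28204aabb5915ebba8c7b4a104c3523bd37dc9a7592302;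
    0x227d993a34a3994c5890d7c67ac016d30e4d8d4049b4c7bf401402b15d14ab5d8f3f;
    0xab8b4049165c3f95b74671bda8501c16c54ab7cb776679204c043bd77dd199592302;
    0xbd9d56486e8dcb42554cbaa73a2a225840cdc3d779b7146d7e3ea8b70467811f083f;
    0x4ab73c4ac58d5a6d874974c1abb53e14ab5d3424cd56c3a756229604d7200a7d374d;
    0x904c387dc99bd3a73a794ccbba8d4ccb20426f24371640b7690e0231a8145db9813f;
    0xb46497a3c16dcb7360b7586652b1d144d779326d873c24371a495d140223ab5d2702;
    0x5d143171673f2c5a080e243b8d7e4f042049bf40c7b7a895b4799bd3a3c356cb7145;
    0xbf4a28ae5d6295bf449b2e7ea8b75095143c3256220ac37966cdd77d042256c3a153;
    0x4673cb954cbacb846ed1b44456c3b179505a95d7262231147d5d0eab02145d243745;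
    0x5d143171673f16490a535d0e24bd84ae3b0420734ac3abbf5aa358d7cd79c395736b;
    0x6f1c450a374f7910167159451f95cba37063270216bfc7d3b440c7a8bf7eb74a8f5d;
    0x9b6032771c663c4f45562212c38a7d993a10a73acd7ac00214b4d3c7a85cbba8b95d;
    0xbf7e3e146b643fc54ab450917ea816b71c699d52c7bdd1569b22047dd7227d374d08;
    0xd1904c793a9bc07a34cd69d779ba204ccb288d1a7140b745b10e164a028f5dab145d;
    0x4673cb954cbacb846e44b1bbd15a795095262c813740a8b7d77d160e693b04204d08;
    0x42201a7179556645993a8a9d0e2e401493bfc7a7555d021440d3b4b1c7ab5abf6071;
    0x73c36a284f6b87bf441c245d531456c3b14022b756cb6dab5a0ed179d76679021671;
    0x4cbdc79b79464f93d3c9b455a764c142343a791a3c71ae7ebf10143eab5a02166937;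
    0x955a6d84402c8f4f2608281cbd6d81405522b7699d560420a8c7b4a7c356d3cb934f;
    0xbd9d56486e8dc34252a3581a374540bfcdc3d7795a6d0a271037ab5aae02164abf87 ].

Lemma covers6 : covers 6 solutions6 = true /\ covers_corner 6 solutions6 = true.
Proof. split; vm_compute; reflexivity. Qed.

Lemma covers7 : covers 7 solutions7 = true /\ covers_corner 7 solutions7 = true.
Proof. split; vm_compute; reflexivity. Qed.

Lemma covers8 : covers 8 solutions8 = true /\ covers_corner 8 solutions8 = true.
Proof. split; vm_compute; reflexivity. Qed.

(** * Reduction to a smaller board and the induction *)

Lemma shrink (j : nat) n m xs ys xf yf :
  6 <= m -> n = m + 3 + 3 * Z.of_nat j -> in_board n xs ys -> in_board m xf yf ->
  2 * xs <= ys -> m - 3 <= ys -> ys < m + 3 -> (m <= ys -> j = O) ->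
  necessary_condition n xs ys xf yf ->
  (forall x y, in_board m x y -> necessary_condition m x y xf yf -> solvable m x y xf yf) ->
  solvable n xs ys xf yf.
Proof.
  intros Hm Hn Bs Bf Hx H1 H2 Hj C IH.
  destruct (open_start n m xs ys) as (a & b & x & y & B & Hc & Hr & Hab & Hb & Hl & R);
    try (unfold in_board in *; lia).
  assert (S : solvable m x y xf yf).
  { apply IH; [exact B |].
    assert (n mod 3 = m mod 3) by (Z.to_euclidean_division_equations; lia).
    unfold necessary_condition in *.
    split; intros Hmod; [apply proj1 in C | apply proj2 in C];
      specialize (C ltac:(lia)); Z.to_euclidean_division_equations; lia. }
  assert (full_below n (m + 3) (start_pos x y)).
  { intros u v _ Hv; unfold start_pos; unfold in_board in B; lia. }
  apply solvable_iff; apply solvable_iff in S.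
  eapply reach_trans; [exact R |].
  apply (reach_trans _ _ (cut m (start_pos x y))).
  (* By [Hr] the new hole is not the right corner [(m - 1, m - 1)]; for [2 <= a], [Hl] likewise
     excludes the left corner [(0, m - 1)]. *)
  - assert (start_pos x y (m - 1) (m - 1) = true)
      by (unfold start_pos; unfold in_board in B; lia).
    destruct Hl as [[Ha Hl] | [-> Hy]].
    + apply (clear_below j); auto; try lia.
      unfold start_pos; unfold in_board in B; lia.
    (* With [a = 0] the cell [(0, m + 2)] is empty, so [clear_below] does not apply; but no further
       strip lies below. *)
    + rewrite Hj in Hn by lia.
      eapply reach_agree_r; [apply strip_clear; auto; lia |].
      intros u v B'; unfold in_board, strip, cut in *; split_ifs.
  - eapply reach_agree_r; [apply (reach_cut m); [lia | exact S] |].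
    intros u v B'; unfold in_board, cut, one_peg in *; lia.
Qed.

Lemma reduce_bottom n xs ys xf yf :
  9 <= n -> in_board n xs ys -> in_board n xf yf ->
  necessary_condition n xs ys xf yf ->
  (forall m x y u v, 6 <= m -> m < n -> in_board m x y -> in_board m u v ->
     necessary_condition m x y u v -> solvable m x y u v) ->
  yf <= n - 4 -> yf <= ys -> 5 <= ys \/ n - 6 <= ys ->
  solvable n xs ys xf yf.
Proof.
  intros Hn.
  assert (W : forall xs ys xf yf, in_board n xs ys -> in_board n xf yf ->
    necessary_condition n xs ys xf yf ->
    (forall m x y u v, 6 <= m -> m < n -> in_board m x y -> in_board m u v ->
      necessary_condition m x y u v -> solvable m x y u v) ->
    yf <= n - 4 -> yf <= ys -> 5 <= ys \/ n - 6 <= ys -> 2 * xs <= ys ->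
    solvable n xs ys xf yf).
  { clear xs ys xf yf; intros xs ys xf yf Bs Bf C IH H1 H2 H3 Hx.
    unfold in_board in *.
    destruct (Z.le_gt_cases ys (n - 4)) as [Hy | Hy].
    (* [n - 3 * q] is the least size congruent to [n] modulo 3 whose board contains row [ys], which
       is thus among its last three rows. It is at least 6 by [H3], and the finish is inside since
       [yf <= ys]. *)
    - set (q := (n - 1 - ys) / 3).
      assert (3 * q <= n - 1 - ys < 3 * q + 3)
        by (unfold q; Z.to_euclidean_division_equations; lia).
      apply (shrink (Z.to_nat (q - 1)) n (n - 3 * q)); unfold in_board; auto; try lia.
      intros x y Bx Cx; apply IH; auto; unfold in_board; lia.
    (* The hole lies in the last three rows, which form the only strip to remove. *)
    - apply (shrink 0 n (n - 3)); unfold in_board; auto; try lia.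
      intros x y Bx Cx; apply IH; auto; unfold in_board; lia. }
  intros Bs Bf C IH H1 H2 H3.
  destruct (Z.le_gt_cases (2 * xs) ys); [apply W; assumption |].
  replace xs with (ys - (ys - xs)) by lia; replace xf with (yf - (yf - xf)) by lia.
  apply solvable_mirror, W; auto using condition_mirror; unfold in_board in *; lia.
Qed.

Lemma solvable_corner n xs ys xf yf :
  9 <= n ->
  0 <= xs -> xs <= 2 -> 0 <= ys - xs -> ys - xs <= 2 ->
  0 <= xf -> xf <= 2 -> 0 <= yf - xf -> yf - xf <= 2 ->
  necessary_condition n xs ys xf yf -> solvable n xs ys xf yf.
Proof.
  intros Hn S1 S2 S3 S4 F1 F2 F3 F4 C.
  assert (exists (m j : nat), n = Z.of_nat m + 3 + 3 * Z.of_nat j /\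
      (m = 6 \/ m = 7 \/ m = 8)%nat) as (m & j & -> & Hm).
  { exists (Z.to_nat (6 + n mod 3)), (Z.to_nat (n / 3 - 3)).
    Z.to_euclidean_division_equations; lia. }
  assert (C' : necessary_condition (Z.of_nat m) xs ys xf yf).
  { assert ((Z.of_nat m + 3 + 3 * Z.of_nat j) mod 3 = Z.of_nat m mod 3) as Hmod
      by (Z.to_euclidean_division_equations; lia).
    unfold necessary_condition in *; rewrite Hmod in C; exact C. }
  destruct Hm as [-> | [-> | ->]];
    [ apply (covers_corner_sound 6 solutions6); [apply covers6 | ..]
    | apply (covers_corner_sound 7 solutions7); [apply covers7 | ..]
    | apply (covers_corner_sound 8 solutions8); [apply covers8 | ..] ]; assumption.
Qed.

Lemma condition_sufficient n : forall xs ys xf yf,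
  6 <= n -> in_board n xs ys -> in_board n xf yf ->
  necessary_condition n xs ys xf yf -> solvable n xs ys xf yf.
Proof.
  induction n as [n IH] using (well_founded_induction (Z.lt_wf 0)).
  intros xs ys xf yf Hn Bs Bf C.
  destruct (Z.le_gt_cases 9 n) as [Hn9 | Hn9].
  2:{ assert (n = 6 \/ n = 7 \/ n = 8) as [-> | [-> | ->]] by lia;
      [ apply (covers_sound 6 solutions6); [apply covers6 | ..]
      | apply (covers_sound 7 solutions7); [apply covers7 | ..]
      | apply (covers_sound 8 solutions8); [apply covers8 | ..] ]; assumption. }
  assert (IH' : forall m x y u v, 6 <= m -> m < n -> in_board m x y -> in_board m u v ->
      necessary_condition m x y u v -> solvable m x y u v)
    by (intros; apply IH; auto; lia).
  (* By reversal the lower of the two cells may be taken as the start. *)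
  assert (Hbot : forall x y u v, in_board n x y -> in_board n u v ->
      necessary_condition n x y u v ->
      Z.min y v <= n - 4 -> 5 <= Z.max y v \/ n - 6 <= Z.max y v -> solvable n x y u v).
  { intros x y u v B1 B2 C1 H1 H2; destruct (Z.le_gt_cases v y).
    - apply reduce_bottom; auto; lia.
    - apply solvable_reverse, reduce_bottom; auto using condition_reverse; lia. }
  assert (Hswap : forall x y u v, solvable n (n - 1 - y) (n - 1 - x) (n - 1 - v) (n - 1 - u) ->
      solvable n x y u v).
  { intros x y u v H; apply solvable_swap in H.
    replace (n - 1 - (n - 1 - x)) with x in H by lia.
    replace (n - 1 - (n - 1 - y)) with y in H by lia.
    replace (n - 1 - (n - 1 - u)) with u in H by lia.
    replace (n - 1 - (n - 1 - v)) with v in H by lia; exact H. }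
  assert (Hmirror : forall x y u v, solvable n (y - x) y (v - u) v -> solvable n x y u v).
  { intros x y u v H; apply solvable_mirror in H.
    replace (y - (y - x)) with x in H by lia; replace (v - (v - u)) with u in H by lia.
    exact H. }
  unfold in_board in Bs, Bf.
  (* Here [a] and [b] are the depths of start and finish below one of the three corners. If [near]
     fails for a corner, [Hbot] applies with that corner on top. *)
  pose (near a b := n - 3 <= Z.min a b \/ Z.max a b <= 4 /\ Z.max a b < n - 6).
  assert (Hnear : forall a b, near a b \/
      Z.min a b <= n - 4 /\ (5 <= Z.max a b \/ n - 6 <= Z.max a b))
    by (unfold near; lia).
  destruct (Hnear ys yf) as [N1 | [K1 K2]]; [| apply Hbot; unfold in_board; auto; lia].
  destruct (Hnear (n - 1 - xs) (n - 1 - xf)) as [N2 | [K1 K2]];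
    [| apply Hswap, Hbot; auto using condition_swap; unfold in_board; lia].
  destruct (Hnear (n - 1 - (ys - xs)) (n - 1 - (yf - xf))) as [N3 | [K1 K2]];
    [| apply Hmirror, Hswap, Hbot; auto using condition_swap, condition_mirror;
       unfold in_board; lia].
  (* The three depths of a cell add up to [2 * (n - 1)], so at most one of [N1], [N2], [N3] holds by
     its second alternative. The other two put start and finish within distance 2 of the same two
     sides, and the corner where these meet is moved to the top. *)
  unfold near in *.
  destruct N1 as [N1 | N1].
  - destruct N2 as [N2 | N2].
    + apply Hmirror, Hswap, solvable_corner; try lia.
      apply condition_swap, condition_mirror, C.
    + apply Hswap, solvable_corner; try lia.
      apply condition_swap, C.
  - apply solvable_corner; try lia; exact C.
Qed.

Theorem theorem2p2 (n xs ys xf yf : Z) :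
  1 <= n -> in_board n xs ys -> in_board n xf yf ->
  (solvable n xs ys xf yf -> necessary_condition n xs ys xf yf) /\
  (6 <= n -> necessary_condition n xs ys xf yf -> solvable n xs ys xf yf).
Proof.
  intros Hn Bs Bf; split.
  - apply solvable_necessary; assumption.
  - intros H6; apply condition_sufficient; assumption.
Qed.
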